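(* Let $\mathcal H$ and $\mathcal G$ be real Hilbert spaces, let $z\in\mathcal H$, let $r\in\mathcal G$, let $C\subset\mathcal H$ and $D\subset\mathcal G$ be closed convex sets, and let $L\colon\mathcal H\to\mathcal G$ be a nonzero bounded linear operator such that $r\in\operatorname{sri}\big(L(C)-D\big)$. Let $x$ be the unique solution to the problem $$\underset{x\in C,\;Lx-r\in D}{\text{minimize}}\;\;\tfrac12\|x-z\|^2,$$ and consider the dual problem $$\underset{v\in\mathcal G}{\text{minimize}}\;\;\tfrac12\|z-L^*v\|^2-\tfrac12d_C^2(z-L^*v)+\sigma_D(v)+\langle v\mid r\rangle.\qquad (D)$$ Let $(b_n)_{n\in\mathbb N}$ be a sequence in $\mathcal H$ with $\sum_{n\in\mathbb N}\|b_n\|<+\infty$, let $(c_n)_{n\in\mathbb N}$ be a sequence in $\mathcal G$ with $\sum_{n\in\mathbb N}\|c_n\|<+\infty$, let $\varepsilon\in\,]0,\min\{1,\|L\|^{-2}\}[$, let $v_0\in\mathcal G$, let $(\gamma_n)_{n\in\mathbb N}$ be a sequence in $[\varepsilon,2\|L\|^{-2}-\varepsilon]$, let $(\lambda_n)_{n\in\mathbb N}$ be a sequence in $[\varepsilon,1]$, and define, for every $n\in\mathbb N$, $$x_n=P_C(z-L^*v_n)+b_n,\qquad v_{n+1}=v_n+\lambda_n\gamma_n\big(Lx_n-r-P_D(\gamma_n^{-1}v_n+Lx_n-r)+c_n\big).$$ Then the following hold. (i) $(v_n)_{n\in\mathbb N}$ converges weakly to a solution $v$ to $(D)$, and $x=P_C(z-L^*v)$.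 (ii) $(x_n)_{n\in\mathbb N}$ converges strongly to $x$.
   Context: For a nonempty convex set $S$ in a Hilbert space, $\operatorname{cone}S=\bigcup_{\lambda>0}\{\lambda x: x\in S\}$, and the strong relative interior is $\operatorname{sri}S=\{x\in S:\operatorname{cone}(S-x)=\overline{\operatorname{span}}(S-x)\}$, where $\overline{\operatorname{span}}$ is the closed linear span (and $\operatorname{sri}\varnothing=\varnothing$; thus the hypothesis forces $C$ and $D$ to be nonempty and the primal problem to be feasible, hence to have a unique solution). $P_S$ is the projector onto a nonempty closed convex set $S$, $d_S(x)=\inf_{y\in S}\|x-y\|$ is the distance function, and $\sigma_S(u)=\sup_{x\in S}\langle x\mid u\rangle$ is the support function. $L^*$ is the adjoint of $L$. *)

(* Defs.v *)
From HB Require Import structures.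
From mathcomp Require Import all_boot all_order all_algebra.
From mathcomp Require Import all_classical all_reals all_analysis.

Set Implicit Arguments.
Unset Strict Implicit.
Unset Printing Implicit Defensive.

Import Order.TTheory GRing.Theory Num.Theory.
Import numFieldNormedType.Exports.

Local Open Scope classical_set_scope.
Local Open Scope ring_scope.

(* A real Hilbert space is a complete normed module whose norm comes from a
   scalar product; [inner] is a positive definite symmetric form in the sense
   of sesquilinear.v, so its lemmas (hermC, linearDl, linearZr, ...) apply. *)
HB.mixin Record CompleteNormedModule_isHilbert (R : realType) (H : Type)
    of CompleteNormedModule R H := {
  inner : {dot H for @idfun R};
  inner_norm : forall x : H, inner x x = `|x| ^+ 2
}.

#[short(type="hilbertType")]
HB.structure Definition Hilbert (R : realType) :=
  {H of CompleteNormedModule_isHilbert R H & CompleteNormedModule R H}.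

Section MinkowskiSets.
Context {R : realType} {H : normedModType R}.
Implicit Types S A B V : set H.

Definition set_sub A B : set H := [set a - b | a in A & b in B].

Definition translate_sub S (x : H) : set H := [set y - x | y in S].

(* The positive multiples only: 0 is in the cone of S only if it is in S. *)
Definition cone S : set H :=
  \bigcup_(t in [set t : R | 0 < t]) [set t *: x | x in S].

Definition linear_subspace V : Prop :=
  V 0 /\ (forall (a : R) x y, V x -> V y -> V (a *: x + y)).

Definition lin_span S : set H := smallest linear_subspace S.

Definition sri S : set H :=
  [set x | S x /\
    cone (translate_sub S x) = closure (lin_span (translate_sub S x))].

End MinkowskiSets.

Definition argmin {T : Type} {d : Order.disp_t} {E : porderType d}
    (f : T -> E) (A : set T) : set T :=
  [set x | A x /\ forall y, A y -> (f x <= f y)%O].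

(* [xget 0 P] is a point of P when P is nonempty and the junk value 0
   otherwise. Nonemptiness of the set below is the projection theorem when S is
   nonempty, closed and convex. *)
Definition projector {R : realType} {H : hilbertType R} (S : set H) (x : H) :
    H :=
  xget 0 (argmin (fun y => `|x - y|) S).

Definition distance {R : realType} {H : hilbertType R} (S : set H) (x : H) :
    R :=
  inf [set `|x - y| | y in S].

Definition support_function {R : realType} {H : hilbertType R} (S : set H)
    (u : H) : \bar R :=
  ereal_sup [set (inner x u)%:E | x in S].

(* Here nonemptiness is the Riesz representation theorem when L is a bounded
   linear operator. *)
Definition adjoint {R : realType} {H G : hilbertType R} (L : H -> G) (v : G) :
    H :=
  xget 0 [set w | forall x, inner (L x) v = inner x w].

Definition opnorm {R : realType} {H G : hilbertType R} (L : H -> G) : R :=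
  sup [set `|L x| | x in [set x : H | `|x| <= 1]].

Definition weak_cvg {R : realType} {H : hilbertType R} (u : nat -> H) (l : H) :
    Prop :=
  forall w : H, inner (u n) w @[n --> \oo] --> inner l w.

Section Problems.
Context {R : realType} {H G : hilbertType R}.
Variables (z : H) (r : G) (C : set H) (D : set G) (L : H -> G).

Definition primal_solution : set H :=
  argmin (fun x : H => 2^-1 * `|x - z| ^+ 2) [set x | C x /\ D (L x - r)].

Definition dual_objective (v : G) : \bar R :=
  ((2^-1 * `|z - adjoint L v| ^+ 2
    - 2^-1 * (distance C (z - adjoint L v)) ^+ 2)%:E
   + support_function D v + (inner v r)%:E)%E.

Definition dual_solution : set G := argmin dual_objective setT.

End Problems.

(* Main.v *)
(* Duality turns the primal problem into the Kuhn-Tucker system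
   [z - L^* v - x \in N_C x], [v \in N_D (L x - r)]; each of its solutions [v]
   solves (D) by weak duality and gives [x = P_C (z - L^* v)].

   A solution exists: let [(x_k, d_k)] minimize
   [|c - z|^2 + k |L c - r - d|^2] over [C * D] and put
   [v_k = k (L x_k - r - d_k)]. The Euler inequality bounds [<v_k, y>] from
   below for every [y] in the cone generated by [L C - D - r]. By the
   qualification condition this cone is a closed subspace, so the components of
   the [v_k] along it are uniformly bounded (Banach-Steinhaus), and a weak limit
   of them is a multiplier.

   The iteration is an inexact relaxed forward-backward method on (D). For a
   Kuhn-Tucker vector [v] and the exact step [y_n] from [v_n], the variational
   inequalities of the two projections give
   [|y_n - v|^2 + a (|y_n - v_n|^2 + |p_n - x|^2) <= |v_n - v|^2] with [a > 0]
   and [p_n = P_C (z - L^* v_n)]. With summable errors, [|v_n - v|] converges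
   and [p_n --> x] strongly; weak cluster points of [v_n] are Kuhn-Tucker
   vectors, so Opial's lemma gives weak convergence. *)

From HB Require Import structures.
Require Import Defs.
From mathcomp Require Import all_boot all_order all_algebra.
From mathcomp Require Import all_classical all_reals all_analysis.
From mathcomp Require Import ring lra.

Set Implicit Arguments.
Unset Strict Implicit.
Unset Printing Implicit Defensive.

Import Order.TTheory GRing.Theory Num.Theory.
Import numFieldNormedType.Exports.

Local Open Scope classical_set_scope.
Local Open Scope ring_scope.

(** * Scalar products and norms along filters *)

Lemma cvg_norm_sq {R : realType} {V : normedModType R} {T : Type}
    (F : set_system T) {FF : Filter F} (f : T -> V) l :
  f @ F --> l -> `|f t| ^+ 2 @[t --> F] --> `|l| ^+ 2.
Proof.
move=> fl; rewrite expr2; under eq_fun do rewrite expr2.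
by apply: cvgM; exact: cvg_norm.
Qed.

Section InnerProduct.
Context {R : realType} {H : hilbertType R}.
Implicit Types (x y w : H) (a : R).

Lemma innerC x y : inner x y = inner y x.
Proof. by rewrite hermC expr0 mul1r. Qed.

Lemma innerDl x y w : inner (x + y) w = inner x w + inner y w.
Proof. exact: linearDl. Qed.

Lemma innerDr x y w : inner w (x + y) = inner w x + inner w y.
Proof. exact: linearDr. Qed.

Lemma innerNl x y : inner (- x) y = - inner x y.
Proof. exact: linearNl. Qed.

Lemma innerNr x y : inner x (- y) = - inner x y.
Proof. exact: linearNr. Qed.

Lemma innerZl a x y : inner (a *: x) y = a * inner x y.
Proof. exact: linearZl_LR. Qed.

Lemma innerZr a x y : inner x (a *: y) = a * inner x y.
Proof. exact: linearZr_LR. Qed.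

Lemma inner0l x : inner 0 x = 0.
Proof. exact: linear0l. Qed.

Lemma inner0r x : inner x 0 = 0.
Proof. exact: linear0r. Qed.

Definition innerE :=
  (innerDl, innerDr, innerNl, innerNr, innerZl, innerZr, inner0l, inner0r).

Lemma inner_ge0 x : 0 <= inner x x.
Proof. by rewrite inner_norm exprn_ge0. Qed.

Lemma normD_sq x y : `|x + y| ^+ 2 = `|x| ^+ 2 + 2 * inner x y + `|y| ^+ 2.
Proof. by rewrite -!inner_norm !innerE (innerC y x); ring. Qed.

Lemma normB_sq x y : `|x - y| ^+ 2 = `|x| ^+ 2 - 2 * inner x y + `|y| ^+ 2.
Proof. by rewrite normD_sq normrN innerNr mulrN. Qed.

Lemma cauchy_schwarz x y : `|inner x y| <= `|x| * `|y|.
Proof.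
have [->|y0] := eqVneq y 0; first by rewrite inner0r !normr0 mulr0.
have ny : 0 < inner y y by rewrite inner_norm exprn_gt0 ?normr_gt0.
rewrite -ler_sqr ?nnegrE ?mulr_ge0// exprMn -!inner_norm -normrX.
rewrite ger0_norm ?sqr_ge0//.
have := inner_ge0 (inner y y *: x - inner x y *: y).
rewrite !innerE (innerC y x) => h.
rewrite -subr_ge0 -(pmulr_rge0 _ ny); apply: le_trans h _.
by rewrite le_eqVlt; apply/orP; left; apply/eqP; ring.
Qed.

Lemma inner_le x y : inner x y <= `|x| * `|y|.
Proof. exact: le_trans (ler_norm _) (cauchy_schwarz x y). Qed.

Lemma inner_polar x y :
  inner x y = 2^-1 * (`|x + y| ^+ 2 - `|x| ^+ 2 - `|y| ^+ 2).
Proof. by rewrite normD_sq; field. Qed.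

Lemma inner_cvg {T : Type} (F : set_system T) {FF : Filter F}
    (f g : T -> H) x y :
  f @ F --> x -> g @ F --> y -> inner (f t) (g t) @[t --> F] --> inner x y.
Proof.
move=> fx gy; rewrite inner_polar.
under eq_fun do rewrite inner_polar.
apply: cvgM; first exact: cvg_cst.
by apply: cvgB; [apply: cvgB|]; apply: cvg_norm_sq => //; exact: cvgD.
Qed.

End InnerProduct.

Lemma norm_le_cvg0 {R : realType} {V : normedModType R} {T : Type}
    (F : set_system T) {FF : Filter F} (f : T -> V) (g : T -> R) :
  (\forall t \near F, `|f t| <= g t) -> g @ F --> (0 : R) -> f @ F --> (0 : V).
Proof.
move=> fg g0; apply/norm_cvg0P.
apply: (@squeeze_cvgr _ _ _ _ (cst 0) g) => //; last exact: cvg_cst.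
by near=> t; rewrite normr_ge0 /=; near: t.
Unshelve. all: by end_near. Qed.

(** * Weak limits along a filter *)

Section WeakLimits.
Context {R : realType} {H : hilbertType R} {T : Type}.
Context (F : set_system T) {FF : ProperFilter F}.

(** The filter is arbitrary because cluster points are taken along ultrafilters; at [\oo] this is
    [weak_cvg]. *)
Definition weak_limit (f : T -> H) (l : H) : Prop :=
  forall h, inner (f t) h @[t --> F] --> inner l h.

Lemma cvg_weak_limit (f : T -> H) l : f @ F --> l -> weak_limit f l.
Proof. by move=> fl h; apply: inner_cvg => //; exact: cvg_cst. Qed.

Lemma weak_limitB (f g : T -> H) l m :
  weak_limit f l -> weak_limit g m -> weak_limit (fun t => f t - g t) (l - m).
Proof.
move=> fl gm h; rewrite innerDl innerNl.
under eq_fun do rewrite innerDl innerNl.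
exact: cvgB.
Qed.

Lemma weak_strong_cvg (f g : T -> H) l m (B : R) :
  (forall t, `|f t| <= B) -> weak_limit f l -> g @ F --> m ->
  inner (f t) (g t) @[t --> F] --> inner l m.
Proof.
move=> fB fl gm.
have -> : (fun t => inner (f t) (g t)) =
    (fun t => inner (f t) m + inner (f t) (g t - m)).
  by apply/funext => t; rewrite -innerDr addrC subrK.
rewrite -[inner l m]addr0; apply: cvgD; first exact: fl.
apply: (@norm_le_cvg0 _ R^o _ _ _ _ (fun t => B * `|g t - m|)).
  apply: nearW => t /=; apply: le_trans (cauchy_schwarz _ _) _.
  by apply: ler_wpM2r.
rewrite -(mulr0 B) -(@normr0 _ H) -(subrr m); apply: cvgM; first exact: cvg_cst.
by apply: cvg_norm; apply: cvgB => //; exact: cvg_cst.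
Qed.

End WeakLimits.

(** * Convex sets and penalized least squares *)

Section ConvexSets.
Context {R : realType} {E : normedModType R}.

Lemma convex_setP (S : set E) : convex_set S ->
  forall x y (t : R), 0 <= t -> t <= 1 -> S x -> S y -> S (x + t *: (y - x)).
Proof.
move=> cS x y t t0 t1 Sx Sy.
have := cS y x (Itv01 t0 t1); rewrite !inE => /(_ Sy Sx).
have -> // : x + t *: (y - x) = t *: y + (1 - t) *: x.
by rewrite scalerBl scale1r scalerBr addrCA.
Qed.

Lemma subspace_convex_set (S : set E) : linear_subspace S -> convex_set S.
Proof.
move=> [S0 Slin] x y t; rewrite !inE => Sx Sy.
have -> : conv t x y = t%:num *: x + ((1 - t%:num) *: y + 0) by rewrite addr0.
by apply: (Slin) => //; apply: Slin.
Qed.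

End ConvexSets.

Lemma cvgn_norm_sq {R : realType} {V : completeNormedModType R}
    (u : nat -> V) (K : R) :
  (forall i j, `|u i - u j| ^+ 2 <= K * (i.+1%:R^-1 + j.+1%:R^-1)) -> cvgn u.
Proof.
move=> uK; apply/cauchy_cvgP/cauchy_exP => e e0.
have K0 : 0 <= K.
  have := le_trans (sqr_ge0 _) (uK 0%N 0%N).
  by rewrite pmulr_lge0// addr_gt0// invr_gt0.
have KN : (K * (n.+1%:R^-1 + n.+1%:R^-1)) @[n --> \oo] --> (0 : R).
  rewrite -(mulr0 K) -[X in K * X](addr0 0); apply: cvgM; first exact: cvg_cst.
  by apply: cvgD; exact: cvg_harmonic.
have [N _ NK] : \forall n \near \oo, K * (n.+1%:R^-1 + n.+1%:R^-1) < e ^+ 2.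
  by apply: (cvgr_lt _ KN); rewrite exprn_gt0.
exists (u N); exists N => // j /= Nj.
rewrite -ball_normE /= -ltr_sqr ?nnegrE ?(ltW e0)//.
apply: le_lt_trans (uK _ _) _; apply: le_lt_trans _ (NK N (leqnn N)).
by rewrite ler_wpM2l// lerD2l lef_pV2 ?posrE// ler_nat.
Qed.

Section LeastSquares.
Context {R : realType} {H G : hilbertType R}.
Variables (L : {linear H -> G}) (C : set H) (D : set G) (z : H) (r : G) (k : R).
Hypotheses (Lc : continuous L) (Cc : closed C) (Ccvx : convex_set C).
Hypotheses (Dc : closed D) (Dcvx : convex_set D) (k0 : 0 < k).
Hypotheses (CD0 : C !=set0 /\ D !=set0).

Let cost (c : H) (d : G) : R := `|c - z| ^+ 2 + k * `|L c - r - d| ^+ 2.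

(** [cost] is quadratic along segments: [t = 1] and [t = 2^-1] together give a parallelogram
    identity, small [t] gives the Euler inequality. *)
Let cost_segment c d c' d' (t : R) :
  cost (c + t *: (c' - c)) (d + t *: (d' - d)) =
  cost c d +
    2 * t * (inner (c - z) (c' - c) +
      k * inner (L c - r - d) (L (c' - c) - (d' - d))) +
    t ^+ 2 * (`|c' - c| ^+ 2 + k * `|L (c' - c) - (d' - d)| ^+ 2).
Proof.
rewrite /cost (linearD L) (linearZ_LR L).
have -> : c + t *: (c' - c) - z = (c - z) + t *: (c' - c) by rewrite addrAC.
have -> : L c + t *: L (c' - c) - r - (d + t *: (d' - d)) =
    (L c - r - d) + t *: (L (c' - c) - (d' - d)).
  by rewrite [in RHS]scalerBr opprD [L c + _ - r]addrAC addrACA.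
rewrite (normD_sq (c - z)) (normD_sq (L c - r - d)) !innerZr !normrZ !exprMn.
rewrite !real_normK ?num_real//.
by ring.
Qed.

Lemma least_squares_minimizer : exists c d, [/\ C c, D d &
  forall c' d', C c' -> D d' -> cost c d <= cost c' d'].
Proof.
have [[c0 Cc0] [d0 Dd0]] := CD0.
pose S := [set cost p.1 p.2 | p in [set p | C p.1 /\ D p.2]].
have cost_ge0 c d : 0 <= cost c d.
  by rewrite addr_ge0 ?mulr_ge0 ?sqr_ge0// ltW.
have Sinf : has_inf S.
  split; first by exists (cost c0 d0); exists (c0, d0).
  by exists 0 => _ [p _ <-].
have Sle c d : C c -> D d -> inf S <= cost c d.
  by move=> Cc' Dd'; apply: ge_inf; [case: Sinf|exists (c, d)].
have /choice[p pP] : forall n : nat, exists p : H * G,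
    [/\ C p.1, D p.2 & cost p.1 p.2 < inf S + n.+1%:R^-1].
  move=> n; have [|_ [p [Cp Dp] <-] lt] := @inf_adherent _ S n.+1%:R^-1 _ Sinf.
    by rewrite invr_gt0.
  by exists p.
have half : (0 <= 2^-1 :> R) /\ (2^-1 <= 1 :> R) by split; lra.
(* Eliminating the linear term of [cost_segment] between [t = 1] and [t = 2^-1] bounds a quarter of
   the quadratic one by the mean of the two costs minus [inf S]; hence the factor 2. *)
have par i j : `|(p i).1 - (p j).1| ^+ 2 +
    k * `|(L (p i).1 - (p i).2) - (L (p j).1 - (p j).2)| ^+ 2 <=
    2 * (i.+1%:R^-1 + j.+1%:R^-1).
  have [Ci Di lti] := pP i; have [Cj Dj ltj] := pP j.
  have m := Sle _ _ (convex_setP Ccvx half.1 half.2 Cj Ci)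
                    (convex_setP Dcvx half.1 half.2 Dj Di).
  have e1 := cost_segment (p j).1 (p j).2 (p i).1 (p i).2 1.
  rewrite !scale1r [(p j).1 + ((p i).1 - _)]addrC in e1.
  rewrite [(p j).2 + ((p i).2 - _)]addrC !subrK in e1.
  rewrite cost_segment in m.
  have -> : L (p i).1 - (p i).2 - (L (p j).1 - (p j).2) =
      L ((p i).1 - (p j).1) - ((p i).2 - (p j).2).
    by rewrite (linearB L) !opprB addrACA [RHS]addrACA; congr (_ + _);
       exact: addrC.
  move: e1 m lti ltj; set A := inner _ _ + _; set B := `|_ - _| ^+ 2 + _.
  move: (cost _ _) (cost _ _) (inf S) A B => c1 c2 m0 A B.
  set a := i.+1%:R^-1; set b := j.+1%:R^-1; move: a b => a b.
  have -> : (2^-1 : R) ^+ 2 = 4^-1 by field.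
  by rewrite expr1n; lra.
have /cvg_ex[c cc] : cvgn (fun n => (p n).1).
  apply: (@cvgn_norm_sq _ _ _ 2) => i j; apply: le_trans _ (par i j).
  by rewrite lerDl mulr_ge0 ?sqr_ge0// ltW.
have /cvg_ex[e ee] : cvgn (fun n => L (p n).1 - (p n).2).
  apply: (@cvgn_norm_sq _ _ _ (k^-1 * 2)) => i j.
  rewrite -mulrA ler_pdivlMl//; apply: le_trans _ (par i j).
  by rewrite lerDr sqr_ge0.
have Lcc : L (p n).1 @[n --> \oo] --> L c.
  by apply: continuous_cvg => //; exact: Lc.
have dd : (p n).2 @[n --> \oo] --> L c - e.
  rewrite (_ : (fun n => (p n).2) = fun n => L (p n).1 - (L (p n).1 - (p n).2)).
    exact: cvgB.
  by apply/funext => n; rewrite opprB addrC subrK.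
exists c, (L c - e).
have Cc' : C c.
  by apply: (@closed_cvg _ _ _ _ _ C Cc _ _ cc); apply: nearW => n;
     have [] := pP n.
have Dd' : D (L c - e).
  by apply: (@closed_cvg _ _ _ _ _ D Dc _ _ dd); apply: nearW => n;
     have [] := pP n.
split=> // c' d' Cc'' Dd''; apply: le_trans _ (Sle _ _ Cc'' Dd'').
have cvgF : cost (p n).1 (p n).2 @[n --> \oo] --> cost c (L c - e).
  apply: cvgD; first by apply: cvg_norm_sq; apply: cvgB => //; exact: cvg_cst.
  apply: cvgM; first exact: cvg_cst.
  by apply: cvg_norm_sq; apply: cvgB => //; apply: cvgB => //; exact: cvg_cst.
have cvgS : (inf S + n.+1%:R^-1) @[n --> \oo] --> inf S.
  by rewrite -[X in _ --> X]addr0; apply: cvgD;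
     [exact: cvg_cst|exact: cvg_harmonic].
by apply: (ler_cvg_to cvgF cvgS); apply: nearW => n; have [_ _ /ltW] := pP n.
Qed.

(* The Euler inequality of the minimization of
   [`|c - z| ^+ 2 + k * `|L c - r - d| ^+ 2] over [C] and [D]. *)
Lemma least_squares_variational : exists c d, [/\ C c, D d &
  forall c' d', C c' -> D d' ->
    inner (z - c) (c' - c) <= k * inner (L c - r - d) (L (c' - c) - (d' - d))].
Proof.
have [c [d [Cc' Dd' mind]]] := least_squares_minimizer.
exists c, d; split=> // c' d' Cc'' Dd''.
set A := inner (c - z) (c' - c) +
  k * inner (L c - r - d) (L (c' - c) - (d' - d)).
set B := `|c' - c| ^+ 2 + k * `|L (c' - c) - (d' - d)| ^+ 2.
have B0 : 0 <= B by rewrite addr_ge0 ?mulr_ge0 ?sqr_ge0// ltW.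
suff : 0 <= A by rewrite /A -(opprB z c) innerNl addrC subr_ge0.
have tAB t : 0 < t -> t <= 1 -> 0 <= 2 * A + t * B.
  move=> t0 t1; have := mind _ _ (convex_setP Ccvx (ltW t0) t1 Cc' Cc'')
    (convex_setP Dcvx (ltW t0) t1 Dd' Dd'').
  rewrite cost_segment -/A -/B => le.
  rewrite -(pmulr_rge0 _ t0).
  apply: le_trans (_ : 0 <= cost c d + 2 * t * A + t ^+ 2 * B - cost c d) _.
    by rewrite subr_ge0.
  by rewrite le_eqVlt; apply/orP; left; apply/eqP; ring.
rewrite leNgt; apply/negP => A0.
have AB : 0 < B - A by lra.
(* This [t] lies in ]0, 1] because [A < 0 <= B], and it makes [2 * A + t * B <= A], a
   contradiction. *)
have := tAB (- A / (B - A)); rewrite divr_gt0 ?oppr_gt0// ler_pdivrMr// mul1r.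
move=> /(_ isT); rewrite lerDr B0 => /(_ isT).
have : - A / (B - A) * B <= - A.
  by rewrite mulrAC ler_pdivrMr// ler_pM2l ?oppr_gt0//; lra.
lra.
Qed.

End LeastSquares.

(** * Projections onto closed convex sets *)

Section Projection.
Context {R : realType} {H : hilbertType R}.
Implicit Types (S : set H) (x y p : H).

(** Least squares with the zero operator and [D = {0}]: the penalty vanishes and the Euler
    inequality becomes the variational inequality of the projection. *)
Lemma projection_exists S x : closed S -> convex_set S -> S !=set0 ->
  exists p, S p /\ forall y, S y -> inner (x - p) (y - p) <= 0.
Proof.
move=> Sc Scvx S0.
have cont0 : continuous (\0 : H -> H) by move=> t; exact: cvg_cst.
have c0 : closed [set 0 : H].
  exact: (accessible_closed_set1 (hausdorff_accessible (@norm_hausdorff _ _))).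
have cvx0 : convex_set ([set 0] : set H).
  apply: subspace_convex_set; split=> // a u v -> ->.
  by rewrite /= scaler0 addr0.
have [] := @least_squares_variational R H H \0 S [set 0] x 0 1 cont0
  Sc Scvx c0 cvx0 ltr01; first by split => //; exists 0.
move=> p [d [Sp -> Ip]]; exists p; split => // y Sy.
by have := Ip y 0 Sy erefl; rewrite /= !subr0 inner0r mulr0.
Qed.

(** The variational inequality gives [|x - p|^2 + |y - p|^2 <= |x - y|^2] on [S], so the minimizer
    picked by [xget] must be [p]. *)
Lemma projectorE S x p : S p ->
  (forall y, S y -> inner (x - p) (y - p) <= 0) -> projector S x = p.
Proof.
move=> Sp Ip.
have pmin y : S y -> `|x - p| ^+ 2 + `|y - p| ^+ 2 <= `|x - y| ^+ 2.
  move=> Sy; have := Ip _ Sy.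
  have -> : x - y = (x - p) - (y - p) by rewrite opprB addrA subrK.
  by rewrite (normB_sq (x - p)); lra.
have [|Sq qmin] := @xgetPex _ (0 : H) (argmin (fun y => `|x - y|) S).
  exists p; split => // y Sy; rewrite -ler_sqr ?nnegrE//.
  by have := pmin _ Sy; have := sqr_ge0 (`|y - p|); lra.
rewrite -/(projector S x) in Sq qmin *.
have := pmin _ Sq; have := qmin _ Sp; rewrite -ler_sqr ?nnegrE// => h1 h2.
apply/eqP; rewrite -subr_eq0 -normr_eq0 -sqrf_eq0 -[_ == _]andTb.
by rewrite eq_le sqr_ge0 andbT; lra.
Qed.

Section ClosedConvex.
Variable S : set H.
Hypotheses (Sc : closed S) (Scvx : convex_set S) (S0 : S !=set0).

Lemma projector_mem x : S (projector S x).
Proof.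
have [p [Sp Ip]] := projection_exists x Sc Scvx S0.
by rewrite (projectorE Sp Ip).
Qed.

Lemma projector_variational x y : S y ->
  inner (x - projector S x) (y - projector S x) <= 0.
Proof.
have [p [Sp Ip]] := projection_exists x Sc Scvx S0.
by rewrite (projectorE Sp Ip); exact: Ip.
Qed.

(** Adding the two variational inequalities, each tested at the other projection, gives
    [|p - q|^2 <= <x - y, p - q>]; Cauchy-Schwarz concludes. *)
Lemma projector_nonexpansive x y : `|projector S x - projector S y| <= `|x - y|.
Proof.
have h1 := projector_variational x (projector_mem y).
have h2 := projector_variational y (projector_mem x).
set p := projector S x in h1 h2 *; set q := projector S y in h1 h2 *.
have h : `|p - q| ^+ 2 <= inner (x - y) (p - q).
  rewrite -inner_norm; move: h1 h2.
  by rewrite !innerE (innerC q p); lra.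
have [->|pq] := eqVneq p q; first by rewrite subrr normr0.
have pq0 : 0 < `|p - q| by rewrite normr_gt0 subr_eq0.
rewrite -(ler_pM2r pq0) -expr2; apply: le_trans h _; exact: inner_le.
Qed.

End ClosedConvex.

(** In a subspace the variational inequality of the projection [p] can be tested at [p + y] and at
    [p - y]. *)
Lemma projector_orthogonal S x y : closed S -> linear_subspace S -> S y ->
  inner (x - projector S x) y = 0.
Proof.
move=> Sc Ss Sy; have Scvx := subspace_convex_set Ss; have [S0 Slin] := Ss.
have Sn0 : S !=set0 by exists 0.
have Sp : S (projector S x) by exact: projector_mem.
have h1 := projector_variational Sc Scvx Sn0 x (Slin 1 _ _ Sy Sp).
have h2 := projector_variational Sc Scvx Sn0 x (Slin (-1) _ _ Sy Sp).
by move: h1 h2; rewrite !addrK !innerZr => h1 h2; lra.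
Qed.

(** With [p] the projection of [l], the inequality [<f t - p, l - p> <= 0] passes to the weak limit
    and gives [|l - p|^2 <= 0]. *)
Lemma closed_convex_weak_limit {T : Type} (F : set_system T)
    {FF : ProperFilter F} S (f : T -> H) l : closed S -> convex_set S ->
  (forall t, S (f t)) -> weak_limit F f l -> S l.
Proof.
move=> Sc Scvx Sf fl.
have S0 : S !=set0 by have [t _] := @filter_ex _ F _ _ filterT; exists (f t).
suff -> : l = projector S l by exact: projector_mem.
apply/eqP; rewrite -subr_eq0 -normr_eq0 -sqrf_eq0 eq_le sqr_ge0 andbT.
rewrite -inner_norm; set p := projector S l.
have cv : inner (f t) (l - p) - inner p (l - p) @[t --> F] -->
    inner (l - p) (l - p).
  have -> : inner (l - p) (l - p) = inner l (l - p) - inner p (l - p).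
    by rewrite innerDl innerNl.
  apply: cvgB; [exact: fl|exact: cvg_cst].
apply: (cvgr_to_le cv); apply: nearW => t.
rewrite -innerNl -innerDl innerC.
exact: projector_variational.
Qed.

End Projection.

(** * Riesz representation, adjoint and operator norm *)

Section Riesz.
Context {R : realType} {H : hilbertType R}.

(** The residual [e] of a projection onto the kernel is orthogonal to it, and every [x] is a
    multiple of [e] modulo the kernel; so [f] is [inner e] up to a factor. *)
Lemma riesz (f : {linear H -> R^o}) : bounded_near f (nbhs (0 : H)) ->
  exists w, forall x, f x = inner w x.
Proof.
move=> /bounded_linear_continuous fcont.
have [f0|/existsNP[x0 /eqP fx0]] := pselect (forall x, f x = 0).
  by exists 0 => x; rewrite f0 inner0l.
pose K := [set x | f x = 0].
have Kc : closed K.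
  apply: ((continuous_closedP f).1 fcont [set 0]).
  exact: (accessible_closed_set1 (hausdorff_accessible (@norm_hausdorff _ _))).
have Ks : linear_subspace K.
  split; first exact: linear0.
  by move=> a u v fu fv; rewrite /K/= (linearP f) fu fv scaler0 addr0.
have Kcvx := subspace_convex_set Ks.
have K0 : K !=set0 by exists 0; exact: Ks.1.
pose p := projector K x0; pose e := x0 - p.
have Kp : f p = 0 := projector_mem Kc Kcvx K0 x0.
have fe : f e != 0 by rewrite /e linearB Kp subr0.
have eK k : f k = 0 -> inner e k = 0 by exact: projector_orthogonal.
have e0 : inner e e != 0.
  rewrite inner_norm sqrf_eq0 normr_eq0.
  by apply: contraNneq fe => ->; rewrite linear0.
exists ((f e / inner e e : R) *: e) => x.
have := eK (x - (f x / f e : R) *: e).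
rewrite (linearB f) (linearZ_LR f) /= [_ *: f e]divfK// subrr => /(_ erefl).
rewrite innerDr innerNr innerZr => ex.
have exE : inner e x = f x / f e * inner e e := subr0_eq ex.
by rewrite innerZl exE mulrCA [f e / _ * _]divfK// [RHS]divfK.
Qed.

End Riesz.

Section BoundedOperator.
Context {R : realType} {H G : hilbertType R}.
Variable L : {linear H -> G}.
Hypothesis Lb : bounded_near L (nbhs (0 : H)).

Let Lbound : exists2 M, 0 < M & forall x, `|L x| <= M * `|x|.
Proof. by have /linear_boundedP/pinfty_ex_gt0[M M0 LM] := Lb; exists M. Qed.

Lemma adjointP x v : inner (L x) v = inner x (adjoint L v).
Proof.
have [M M0 LM] := Lbound.
pose f x := inner v (L x) : R^o.
have lf : linear f by move=> a y w; rewrite /f linearP innerDr innerZr.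
pose flin := GRing.isLinear.Build _ _ _ _ f lf.
pose F : {linear H -> R^o} := HB.pack f flin.
have [|w wP] := @riesz R H F.
  apply/linear_boundedP; near=> r => y.
  apply: le_trans (cauchy_schwarz _ _) _.
  apply: (@le_trans _ _ (`|v| * (M * `|y|))); first exact: ler_wpM2l.
  by rewrite mulrA ler_wpM2r//; near: r; exact: nbhs_pinfty_ge.
have ex : exists u, forall y, inner (L y) v = inner y u.
  by exists w => y; rewrite innerC [RHS]innerC -wP.
exact: (xgetPex 0 ex x).
Unshelve. all: by end_near. Qed.

Lemma opnormP x : `|L x| <= opnorm L * `|x|.
Proof.
have [M M0 LM] := Lbound.
have ub : has_sup [set `|L x| | x in [set x : H | `|x| <= 1]].
  split; first by exists `|L 0|, 0 => //=; rewrite normr0.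
  exists M => _ [y /= y1 <-]; apply: le_trans (LM y) _.
  by rewrite ler_piMr// ltW.
have [->|x0] := eqVneq x 0; first by rewrite linear0 !normr0 mulr0.
have nx : 0 < `|x| by rewrite normr_gt0.
rewrite -ler_pdivrMr//.
have -> : `|L x| / `|x| = `|L (`|x|^-1 *: x)|.
  by rewrite linearZ_LR normrZ gtr0_norm ?invr_gt0// mulrC.
apply: sup_upper_bound => //; exists (`|x|^-1 *: x) => //=.
by rewrite normrZ gtr0_norm ?invr_gt0// mulVf// gt_eqF.
Qed.

Lemma opnorm_gt0 : (exists u, L u != 0) -> 0 < opnorm L.
Proof.
move=> [u Lu]; have Lu0 : 0 < `|L u| by rewrite normr_gt0.
have := lt_le_trans Lu0 (opnormP u); rewrite pmulr_lgt0// normr_gt0.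
by apply: contraNneq Lu => ->; rewrite linear0.
Qed.

End BoundedOperator.

(** * Weak compactness along ultrafilters *)

(** The image ultrafilter lives on a compact segment and has a cluster point; for an ultrafilter a
    cluster point is a limit. *)
Lemma ultra_bounded_cvg {R : realType} {T : Type} (U : set_system T)
    {UU : UltraFilter U} (f : T -> R) (B : R) :
  (forall t, `|f t| <= B) -> cvg (f @ U).
Proof.
move=> fB.
have FF : ProperFilter (f @ U) by exact: fmap_proper_filter.
have [|p [_ clp]] := @segment_compact R (- B) B (f @ U) FF.
  by apply: (@filterE _ U) => t /=; rewrite in_itv/= -ler_norml.
apply/cvg_ex; exists p => V Vp.
have [//|nV] := in_ultra_setVsetC (f @^-1` V) UU.
by have [y [/= ny yV]] := clp _ _ (nV : (f @ U) (~` V)) Vp.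
Qed.

(** The limits of [inner (f t) h] along [U] form a bounded linear functional of [h], which Riesz
    represents by a vector. *)
Lemma ultra_weak_limit {R : realType} {H : hilbertType R} {T : Type}
    (U : set_system T) {UU : UltraFilter U} (f : T -> H) (B : R) :
  (forall t, `|f t| <= B) -> exists l, weak_limit U f l.
Proof.
move=> fB.
have fhB h t : `|inner (f t) h| <= B * `|h|.
  by apply: le_trans (cauchy_schwarz _ _) _; exact: ler_wpM2r.
have cv h : inner (f t) h @[t --> U] --> lim (inner (f t) h @[t --> U]).
  exact: (ultra_bounded_cvg (fhB h)).
pose phi h := lim (inner (f t) h @[t --> U]) : R^o.
have lf : linear phi.
  move=> a x y; apply/cvg_lim => //.
  rewrite (_ : (fun t => _) = fun t => a * inner (f t) x + inner (f t) y).
    by apply: cvgD; [apply: cvgM; [exact: cvg_cst|exact: cv]|exact: cv].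
  by apply/funext => t; rewrite innerDr innerZr.
pose flin := GRing.isLinear.Build _ _ _ _ phi lf.
pose F : {linear H -> R^o} := HB.pack phi flin.
have [|w wP] := @riesz R H F.
  apply/linear_boundedP; near=> r => y.
  apply: (@le_trans _ _ (B * `|y|)).
    rewrite ler_norml; apply/andP; split.
      apply: (cvgr_to_ge (cv y)); apply: nearW => t.
      by have := fhB y t; rewrite ler_norml => /andP[].
    apply: (cvgr_to_le (cv y)); apply: nearW => t.
    by have := fhB y t; rewrite ler_norml => /andP[].
  by rewrite ler_wpM2r//; near: r; exact: nbhs_pinfty_ge.
by exists w => h; rewrite -wP; exact: cv.
Unshelve. all: by end_near. Qed.

(** * Closed subspaces and uniform boundedness *)

Section Subspaces.
Context {R : realType} {V : normedModType R}.

Lemma lin_span_subspace (S : set V) : linear_subspace (lin_span S).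
Proof.
split; first by move=> W [[W0 _] _].
move=> a x y Sx Sy W WP; have [[_ Wlin] _] := WP.
by apply: Wlin; [exact: Sx|exact: Sy].
Qed.

Lemma closure_subspace (S : set V) :
  linear_subspace S -> linear_subspace (closure S).
Proof.
move=> [S0 Slin]; split; first exact: subset_closure.
move=> a x y Sx Sy B nB.
have cont : continuous (fun p : V * V => a *: p.1 + p.2).
  move=> p; apply: cvgD; last exact: cvg_snd.
  by apply: cvgZr; exact: cvg_fst.
have [[P Q] /= [nP nQ] PQ] := cont (x, y) _ nB.
have [u [Su Pu]] := Sx _ nP; have [w [Sw Qw]] := Sy _ nQ.
by exists (a *: u + w); split; [exact: Slin|exact: (PQ (u, w))].
Qed.

End Subspaces.

(* Banach-Steinhaus on a closed subspace [M]: only the component of [v n]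
   along [M] is controlled. *)
Lemma subspace_uniform_bounded {R : realType} {G : hilbertType R} (M : set G)
    (v : nat -> G) : closed M -> linear_subspace M ->
  (forall y, M y -> exists B, forall n, `|inner (v n) y| <= B) ->
  exists (u : nat -> G) (B : R), (forall n, `|u n| <= B) /\
    forall n y, M y -> inner (u n) y = inner (v n) y.
Proof.
move=> Mc Ms vB; have Mcvx := subspace_convex_set Ms.
have M0 : M !=set0 by exists 0; exact: Ms.1.
pose u n := projector M (v n).
have uv n y : M y -> inner (u n) y = inner (v n) y.
  move=> My; have := projector_orthogonal (v n) Mc Ms My.
  by rewrite innerDl innerNl => /subr0_eq.
pose F : set (G -> R^o) := [set (fun y => inner (u n) y) | n in setT].
have [||B FB] := @Banach_Steinhauss R G R^o F _ _ 1.
- move=> _ [n _ <-]; split.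
    move=> q; exists (`|u n| * q) => y yq.
    by apply: le_trans (cauchy_schwarz _ _) _; exact: ler_wpM2l.
  by move=> a y w; rewrite innerDr innerZr.
(* As [u n] lies in [M], it only sees the component of [y] along [M]; this extends pointwise
   boundedness from [M] to the whole space, as Banach-Steinhaus requires. *)
- move=> y; have MP := projector_mem Mc Mcvx M0.
  have [B yB] := vB _ (MP y).
  exists B => _ [n _ <-].
  have -> : inner (u n) y = inner (u n) (projector M y).
    apply/eqP; rewrite -subr_eq0 -innerNr -innerDr innerC.
    by rewrite projector_orthogonal//; exact: MP.
  by rewrite uv.
exists u, B; split=> // n.
have [->|u0] := eqVneq (u n) 0.
  have := FB (fun y => inner (u n) y) (ex_intro2 _ _ n I erefl) 0.
  by rewrite inner0r !normr0; exact.
have nu : 0 < `|u n| by rewrite normr_gt0.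
have := FB (fun y => inner (u n) y) (ex_intro2 _ _ n I erefl)
  (`|u n|^-1 *: u n).
rewrite normrZ gtr0_norm ?invr_gt0// mulVf ?gt_eqF// => /(_ (lexx _)).
rewrite innerZr inner_norm expr2 mulKf ?gt_eqF//.
exact: le_trans (ler_norm _).
Qed.

(** Polarization gives [4 <a, b> = |a + b|^2 - |a - b|^2]. For [a = z - c_n] and [b = c - c_n] the
    resulting bound does not involve [c_n]. *)
Lemma inner_ge_dist {R : realType} {H : hilbertType R} (a b : H) :
  - (4^-1 * `|a - b| ^+ 2) <= inner a b.
Proof.
by have := sqr_ge0 `|a + b|; rewrite (normD_sq a b) (normB_sq a b); lra.
Qed.

Lemma cone_sub (R : realType) (V : normedModType R) (S : set V) x y :
  S y -> cone (translate_sub S x) (y - x).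
Proof.
by move=> Sy; exists 1 => //=; exists (y - x); [exists y|rewrite scale1r].
Qed.

Lemma norm_sq_cvg0 {R : realType} {V : normedModType R} {T : Type}
    (F : set_system T) {FF : Filter F} (f : T -> V) :
  `|f t| ^+ 2 @[t --> F] --> (0 : R) -> f @ F --> (0 : V).
Proof.
move=> f0; apply/norm_cvg0P.
rewrite (_ : (fun t => `|f t|) = fun t => Num.sqrt (`|f t| ^+ 2)); last first.
  by apply/funext => t; rewrite sqrtr_sqr normr_id.
rewrite -[X in _ --> X]sqrtr0.
by apply: (continuous_cvg _ (@sqrt_continuous _ _)).
Qed.

(** * Existence of a Lagrange multiplier *)

Section LagrangeMultiplier.
Context {R : realType} {H G : hilbertType R}.
Variables (z : H) (r : G) (C : set H) (D : set G) (L : {linear H -> G}) (x : H).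
Hypotheses (Cc : closed C) (Ccvx : convex_set C).
Hypotheses (Dc : closed D) (Dcvx : convex_set D).
Hypotheses (Lb : bounded_near L (nbhs (0 : H))).
Hypotheses (rsri : sri (set_sub (L @` C) D) r).
Hypotheses (xP : primal_solution z r C D L x).

Let Lcont : continuous L := bounded_linear_continuous Lb.

(** The Euler inequality with the square of the residual [L c - r - d] moved to the left;
    [k *: (L c - r - d)] is the approximate multiplier. *)
Let penalized (k : R) : 0 < k -> exists c d, [/\ C c, D d &
  forall c' d', C c' -> D d' ->
    inner (z - c) (c' - c) + k * `|L c - r - d| ^+ 2 <=
      inner (k *: (L c - r - d)) (L c' - r - d')].
Proof.
move=> k0; have [[Cx DLx] _] := xP.
have [] := least_squares_variational z r Lcont Cc Ccvx Dc Dcvx k0.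
  by split; [exists x|exists (L x - r)].
move=> c [d [Ccc Ddd cdP]]; exists c, d; split=> // c' d' Cc' Dd'.
have -> : L c' - r - d' = (L c - r - d) + (L (c' - c) - (d' - d)).
  rewrite (linearB L) !opprB [RHS]addrC [RHS]addrACA.
  by rewrite subrKA [d - d' - d]addrAC subrr add0r.
rewrite [leRHS]innerDr !innerZl inner_norm.
have := cdP _ _ Cc' Dd'; lra.
Qed.

Lemma lagrange_multiplier : exists v, forall c d, C c -> D d ->
  inner (z - x) (c - x) <= inner v (L c - r - d).
Proof.
have [[Cx DLx] xmin] := xP.
have /choice[p pP] : forall n : nat, exists p : H * G, [/\ C p.1, D p.2 &
  forall c' d', C c' -> D d' ->
    inner (z - p.1) (c' - p.1) + n.+1%:R * `|L p.1 - r - p.2| ^+ 2 <=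
      inner (n.+1%:R *: (L p.1 - r - p.2)) (L c' - r - d')].
  move=> n; have [//|c [d cdP]] := @penalized n.+1%:R.
  by exists (c, d).
pose e n := L (p n).1 - r - (p n).2.
pose v n := n.+1%:R *: e n.
have vge n c d : C c -> D d ->
    inner (z - (p n).1) (c - (p n).1) <= inner (v n) (L c - r - d).
  move=> Cc' Dd'; have [_ _ /(_ _ _ Cc' Dd')] := pP n.
  by apply: le_trans; rewrite lerDl mulr_ge0 ?sqr_ge0.
have penx n : inner (z - (p n).1) (x - (p n).1) + n.+1%:R * `|e n| ^+ 2 <= 0.
  by have [_ _ /(_ _ _ Cx DLx)] := pP n; rewrite subrr inner0r.
pose M := closure (lin_span (translate_sub (set_sub (L @` C) D) r)).
have Ms : linear_subspace M.
  by apply: closure_subspace; exact: lin_span_subspace.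
have MK : M = cone (translate_sub (set_sub (L @` C) D) r) by case: rsri.
have Mdiff c d : C c -> D d -> M (L c - r - d).
  move=> Cc' Dd'; rewrite MK addrAC; apply: cone_sub.
  by exists (L c); [exists c|exists d].
(* By the qualification condition every [y] of [M] is a positive multiple of some [L c - d - r],
   where [vge] applies. *)
have vlow y : M y -> exists B, forall n, B <= inner (v n) y.
  rewrite MK => -[t /= t0 [_ [_ [_ [c Cc' <-] [d Dd' <-]] <-] <-]].
  exists (t * - (4^-1 * `|z - c| ^+ 2)) => n; rewrite innerZr ler_pM2l//.
  rewrite addrAC; apply: le_trans _ (vge n _ _ Cc' Dd').
  have := inner_ge_dist (z - (p n).1) (c - (p n).1).
  by rewrite opprB addrA subrK.
(* [M] also contains [- y], which turns lower bounds into two-sided ones. *)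
have vbnd y : M y -> exists B, forall n, `|inner (v n) y| <= B.
  move=> My; have [B1 B1P] := vlow _ My.
  have [|B2 B2P] := vlow (- y).
    by have := Ms.2 (-1) _ _ My Ms.1; rewrite addr0 scaleN1r.
  exists (Num.max (- B1) (- B2)) => n.
  have := B1P n; have := B2P n; rewrite innerNr => h2 h1.
  have m1 : - B1 <= Num.max (- B1) (- B2) by rewrite le_max lexx.
  have m2 : - B2 <= Num.max (- B1) (- B2) by rewrite le_max lexx orbT.
  by rewrite ler_norml; apply/andP; split; lra.
(* Only the components [u n] of [v n] along [M] are known to be bounded; they suffice because
   [L c - r - d] lies in [M]. *)
have [u [B [uB uv]]] := subspace_uniform_bounded (@closed_closure _ _) Ms vbnd.
have [U [UU subU]] := ultraFilterLemma (@eventually_filter).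
have [w uw] := ultra_weak_limit uB.
pose K := `|x - z|.
(* With [c_n] for [(p n).1], [penx] gives [|x - c_n|^2 <= <x - z, x - c_n>], hence
   [|x - c_n| <= K]. *)
have xbnd n : `|(p n).1| <= `|x| + K.
  have := penx n; have := sqr_ge0 `|e n|; have n0 : 0 < n.+1%:R :> R by [].
  rewrite -(pmulr_rge0 _ n0) => h1 h2.
  have h3 : inner (z - (p n).1) (x - (p n).1) <= 0 by lra.
  have h4 : `|x - (p n).1| ^+ 2 <= K * `|x - (p n).1|.
    apply: le_trans (inner_le _ _); rewrite -inner_norm.
    rewrite -subr_ge0 -innerNl -innerDl.
    have -> : x - z - (x - (p n).1) = - (z - (p n).1).
      by rewrite !opprB [LHS]addrC subrKA.
    by rewrite innerNl oppr_ge0.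
  have h5 : `|x - (p n).1| <= K.
    have [->|x0] := eqVneq (x - (p n).1) 0; first by rewrite normr0 normr_ge0.
    by rewrite -(@ler_pM2r _ `|x - (p n).1|) ?normr_gt0// -expr2.
  have -> : (p n).1 = x - (x - (p n).1) by rewrite subKr.
  by apply: le_trans (ler_normB _ _) _; rewrite lerD2l.
have [x' xx'] := ultra_weak_limit xbnd.
have cvU (f : nat -> R) l : f @ \oo --> l -> f @ U --> l.
  by move=> fl A /fl /subU.
(* [penx] and [inner_ge_dist] give [|e n|^2 <= K^2 / (4 (n + 1))]. *)
have e0 : e @ U --> (0 : G).
  have sq : (fun n => `|e n| ^+ 2) @ U --> (0 : R).
    apply: cvU; apply: (@norm_le_cvg0 _ R^o _ _ _ _
      (fun n => 4^-1 * K ^+ 2 * n.+1%:R^-1)).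
      apply: nearW => n; rewrite ger0_norm ?sqr_ge0//.
      have := penx n; have := inner_ge_dist (z - (p n).1) (x - (p n).1).
      rewrite opprB addrA subrK -normrN opprB -/K => h1 h2.
      by rewrite ler_pdivlMr// mulrC; lra.
    by rewrite -[X in _ --> X](mulr0 (4^-1 * K ^+ 2)); apply: cvgM;
      [exact: cvg_cst|exact: cvg_harmonic].
  exact: norm_sq_cvg0.
have Cx' : C x'.
  by apply: (closed_convex_weak_limit Cc Ccvx _ xx') => n; have [] := pP n.
have DLx' : D (L x' - r).
  apply: (@closed_convex_weak_limit _ _ _ U _ D (fun n => (p n).2)) => //.
    by move=> n; have [] := pP n.
  have -> : (fun n => (p n).2) = fun n => L (p n).1 - r - e n.
    by apply/funext => n; rewrite /e subKr.
  rewrite -[L x' - r]subr0; apply: weak_limitB; last exact: cvg_weak_limit.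
  apply: weak_limitB; last by apply: cvg_weak_limit; exact: cvg_cst.
  move=> h; rewrite adjointP//; under eq_fun do rewrite adjointP//.
  exact: xx'.
have feas n c : C c -> D (L c - r) -> inner (z - (p n).1) (c - (p n).1) <= 0.
  by move=> Cc' /(vge n _ _ Cc'); rewrite subrr inner0r.
(* Weak convergence becomes strong: [feas] at [x'] reads [|c_n - x'|^2 <= <c_n - x', z - x'>], whose
   right side tends to 0. *)
have xs : (fun n => (p n).1) @ U --> x'.
  have sub0 : (fun n => (p n).1 - x') @ U --> (0 : H).
    apply: norm_sq_cvg0.
    apply: (@norm_le_cvg0 _ R^o _ _ _ _
      (fun n => inner ((p n).1 - x') (z - x'))).
      apply: nearW => n; rewrite ger0_norm ?sqr_ge0//.
      have := feas n _ Cx' DLx'.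
      have -> : inner (z - (p n).1) (x' - (p n).1) =
          inner (z - x') (x' - (p n).1) + `|x' - (p n).1| ^+ 2.
        by rewrite -[z - (p n).1](subrKA x') (innerDl (z - x')) inner_norm.
      by rewrite -(opprB (p n).1 x') normrN innerNr innerC; lra.
    rewrite -(inner0l (z - x')) -(subrr x').
    by apply: weak_limitB => //; apply: cvg_weak_limit; exact: cvg_cst.
  rewrite -[x']add0r.
  rewrite (_ : (fun n => (p n).1) = fun n => ((p n).1 - x') + x'); last first.
    by apply/funext => n; rewrite subrK.
  by apply: cvgD => //; exact: cvg_cst.
have icvg c : inner (z - (p n).1) (c - (p n).1) @[n --> U] -->
    inner (z - x') (c - x').
  by apply: inner_cvg; (apply: cvgB => //; exact: cvg_cst).
(* The limit satisfies the variational inequality tested at [x], and [x] is no farther from [z] than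
   [x'], so [|x - x'|^2 <= 0]. *)
have x'E : x' = x.
  have h1 : inner (z - x') (x - x') <= 0.
    by apply: (cvgr_to_le (icvg x)); apply: nearW => n; exact: feas.
  have h2 := xmin x' (conj Cx' DLx').
  have h3 : x - z = (x - x') - (z - x') by rewrite opprB subrKA.
  have h4 := sqr_ge0 `|x - x'|.
  rewrite h3 (normB_sq (x - x')) innerC -(opprB z x') normrN in h2.
  apply/esym/eqP; rewrite -subr_eq0 -normr_eq0 -sqrf_eq0 eq_le h4 andbT.
  by lra.
exists w => c d Cc' Dd'; rewrite -subr_ge0.
have lim : (inner (u n) (L c - r - d) - inner (z - (p n).1) (c - (p n).1))
    @[n --> U] --> inner w (L c - r - d) - inner (z - x) (c - x).
  by apply: cvgB; [exact: uw|rewrite -x'E; exact: icvg].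
apply: (cvgr_to_ge lim); apply: nearW => n.
by rewrite subr_ge0 uv ?vge//; exact: Mdiff.
Qed.

End LagrangeMultiplier.

(** * Quasi-Fejer sequences of reals *)

Section RealSequences.
Context {R : realType}.
Implicit Types (a e q : nat -> R).

Lemma nneseries_lty_bounded a : (forall n, 0 <= a n) ->
  (\sum_(0 <= n <oo) (a n)%:E < +oo)%E ->
  exists B, forall n, \sum_(0 <= i < n) a i <= B.
Proof.
move=> a0 alty; set s := (\sum_(0 <= n <oo) _)%E in alty.
have leS n : ((\sum_(0 <= i < n) a i)%:E <= s)%E.
  rewrite -sumEFin; apply: (nneseries_lim_ge (P := xpredT)) => i _ _.
  by rewrite lee_fin.
exists (fine s) => n; rewrite -lee_fin fineK//.
by rewrite ge0_fin_numE//; apply: le_trans _ (leS 0%N); rewrite big_geq.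
Qed.

Lemma bounded_series_cvg a : (forall n, 0 <= a n) ->
  (exists B, forall n, \sum_(0 <= i < n) a i <= B) -> cvgn (series a).
Proof.
move=> a0 [B aB]; apply: nondecreasing_is_cvgn.
  by apply/nondecreasing_seqP => n; rewrite /series/= big_nat_recr//= lerDl.
by exists B => _ [n _ <-]; exact: aB.
Qed.

(** [s] stands for the distance after an exact step and [e n] for the error. Then [a n - series e n]
    is nonincreasing, and [q n] is squeezed by [a n ^+ 2 - a n.+1 ^+ 2 + 2 * e n * a n.+1]. *)
Lemma quasi_fejer a q e :
  (forall n, 0 <= a n) -> (forall n, 0 <= q n) -> (forall n, 0 <= e n) ->
  (exists B, forall n, \sum_(0 <= i < n) e i <= B) ->
  (forall n, exists s,
    [/\ 0 <= s, s ^+ 2 + q n <= a n ^+ 2 & a n.+1 <= s + e n]) ->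
  cvgn a /\ q @ \oo --> (0 : R).
Proof.
move=> a0 q0 e0 eB step.
have sa n s : 0 <= s -> s ^+ 2 + q n <= a n ^+ 2 -> s <= a n.
  by move=> s0 h; rewrite -ler_sqr ?nnegrE//; have := q0 n; lra.
have aS n : a n.+1 <= a n + e n.
  have [s [s0 sq ase]] := step n; apply: le_trans ase _.
  by rewrite lerD2r; exact: sa.
have cS := bounded_series_cvg e0 eB.
have ca : cvgn a.
  have cd : cvgn (fun n => a n - series e n).
    apply: nonincreasing_is_cvgn.
      apply/nonincreasing_seqP => n; rewrite /series/= big_nat_recr//=.
      by have := aS n; lra.
    case: eB => B eB; exists (- B) => _ [n _ <-].
    by have := a0 n; have := eB n; rewrite /series/=; lra.
  rewrite (_ : a = fun n => (a n - series e n) + series e n).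
    exact: is_cvgD.
  by apply/funext => n; rewrite subrK.
split=> //.
have /cvg_ex[l al] := ca.
have aSl : a n.+1 @[n --> \oo] --> l by have := al; rewrite -cvg_shiftS.
have eto0 := cvg_series_cvg_0 cS.
apply: (@squeeze_cvgr _ _ _ _ (cst 0)
    (fun n => a n * a n - a n.+1 * a n.+1 + 2 * (e n * a n.+1))).
- apply: nearW => n; rewrite q0/=; have [s [s0 sq ase]] := step n.
  (* [a n.+1 - e n <= s] may be squared when its left side is nonnegative; otherwise
     [a n.+1 ^+ 2 <= e n * a n.+1]. *)
  have [h|h] := lerP (e n) (a n.+1).
    have : (a n.+1 - e n) ^+ 2 <= s ^+ 2.
      by rewrite ler_sqr ?nnegrE//; lra.
    rewrite sqrrB; have := sqr_ge0 (e n); rewrite -!expr2 -[e n * _]mulrC; lra.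
  have h1 : a n.+1 * a n.+1 <= e n * a n.+1 by rewrite ler_wpM2r// ltW.
  have h2 := sqr_ge0 s; have h3 : 0 <= e n * a n.+1 by exact: mulr_ge0.
  by rewrite -expr2; lra.
- exact: cvg_cst.
rewrite (_ : 0 = l * l - l * l + 2 * (0 * l)); last by ring.
apply: cvgD; first by apply: cvgB; exact: cvgM.
by apply: cvgM; [exact: cvg_cst|exact: cvgM].
Qed.

End RealSequences.

(** * Opial's lemma *)

(** If the preimage of a neighbourhood [A] is not in [F], then [F] restricted to its complement is
    proper, and an ultrafilter above it contradicts the hypothesis. *)
Lemma ultra_cvg {T : Type} {V : topologicalType} (F : set_system T)
    {FF : ProperFilter F} (f : T -> V) (l : V) :
  (forall U, UltraFilter U -> F `<=` U -> f @ U --> l) -> f @ F --> l.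
Proof.
move=> fU A lA; apply: contrapT => nFA.
have PF : ProperFilter (within (~` (f @^-1` A)) F).
  apply: Build_ProperFilter => F0; apply: nFA.
  by apply: (@filterS _ F FF _ _ _ F0) => t /= /contrapT.
have [U [UU subU]] := ultraFilterLemma PF.
have FU : F `<=` U.
  by move=> P FP; apply: subU; apply: (@filterS _ F FF _ _ _ FP) => t Pt _.
have nA : U (~` (f @^-1` A)) by apply: subU; exact: withinT.
have UA : U (f @^-1` A) := fU U UU FU A lA.
have [t [At nAt]] := @filter_ex _ U _ _ (filterI UA nA).
exact: nAt.
Qed.

(* Opial's lemma, with ultrafilters in place of weakly convergent
   subsequences. *)
Lemma opial {R : realType} {H : hilbertType R} (v : nat -> H) (S : set H) B :
  (forall n, `|v n| <= B) ->
  (forall w, S w -> cvgn (fun n => `|v n - w|)) ->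
  (forall U, UltraFilter U -> \oo `<=` U ->
     forall w, weak_limit U v w -> S w) ->
  exists w, S w /\ weak_cvg v w.
Proof.
move=> vB vcvg vS.
have [U0 [UU0 subU0]] := ultraFilterLemma eventually_filter.
have [w0 vw0] := ultra_weak_limit vB.
have Sw0 := vS _ UU0 subU0 _ vw0.
exists w0; split=> // h; apply: ultra_cvg => U UU subU.
have [w vw] := @ultra_weak_limit _ _ _ U _ _ _ vB.
suff -> : w0 = w by exact: vw.
have Sw := vS _ UU subU _ vw.
(* [|v n - w0|^2 - |v n - w|^2] equals [-2 <v n, w0 - w>] up to a constant, so this pairing
   converges along [\oo]; both ultrafilter limits then give it the same value, and [w0 = w]. *)
have /cvg_ex[l vl] : cvgn (fun n => inner (v n) (w0 - w)).
  rewrite (_ : (fun n => _) = fun n => 2^-1 * (`|w0| ^+ 2 - `|w| ^+ 2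
      - (`|v n - w0| * `|v n - w0| - `|v n - w| * `|v n - w|))); last first.
    by apply/funext => n; rewrite -!expr2 !normB_sq innerDr innerNr; field.
  apply: is_cvgM; first exact: is_cvg_cst.
  apply: is_cvgB; first exact: is_cvg_cst.
  by apply: is_cvgB; apply: is_cvgM; exact: vcvg.
have lU (U' : set_system nat) : UltraFilter U' -> \oo `<=` U' ->
    forall w', weak_limit U' v w' -> inner w' (w0 - w) = l.
  move=> UU' subU' w' vw'.
  have h1 : inner (v n) (w0 - w) @[n --> U'] --> l by move=> A /vl /subU'.
  exact: (cvg_unique (@norm_hausdorff _ _) (vw' (w0 - w)) h1).
apply/eqP; rewrite -subr_eq0 -normr_eq0 -sqrf_eq0 -inner_norm innerDl innerNl.
by rewrite (lU _ UU0 subU0 _ vw0) (lU _ UU subU _ vw) subrr.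
Qed.

(** * Kuhn-Tucker vectors and duality *)

Section KuhnTucker.
Context {R : realType} {H G : hilbertType R}.
Variables (z : H) (r : G) (C : set H) (D : set G) (L : {linear H -> G}) (x : H).
Hypothesis Lb : bounded_near L (nbhs (0 : H)).

Definition kuhn_tucker (v : G) : Prop :=
  (forall c, C c -> inner (z - adjoint L v - x) (c - x) <= 0) /\
  (forall d, D d -> inner v (d - (L x - r)) <= 0).

Lemma lagrange_kuhn_tucker v : C x -> D (L x - r) ->
  (forall c d, C c -> D d -> inner (z - x) (c - x) <= inner v (L c - r - d)) ->
  kuhn_tucker v.
Proof.
move=> Cx DLx vP; split=> [c Cc|d Dd].
  have := vP _ _ Cc DLx.
  have -> : L c - r - (L x - r) = L (c - x).
    by rewrite (linearB L) opprB addrA subrK.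
  rewrite -subr_le0 [inner v _]innerC adjointP// [inner (c - x) _]innerC.
  rewrite -innerNl -innerDl.
  by rewrite addrAC.
have := vP _ _ Cx Dd; rewrite subrr inner0r -[d - _]opprB innerNr.
by rewrite oppr_le0.
Qed.

Lemma kuhn_tucker_projector v : C x -> kuhn_tucker v ->
  projector C (z - adjoint L v) = x.
Proof. by move=> Cx [vC _]; exact: projectorE. Qed.

(** [m] is [|z|^2 / 2] minus the primal value. Replacing the distance to [C] by the distance to [x]
    and the support function by its term at [L x - r] lowers the dual objective to [m] at every
    point; at a Kuhn-Tucker vector both replacements are exact. *)
Lemma kuhn_tucker_dual_solution v : C x -> D (L x - r) -> kuhn_tucker v ->
  dual_solution z r C D L v.
Proof.
move=> Cx DLx [vC vD]; split=> // w _.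
pose m : R := inner z x - 2^-1 * `|x| ^+ 2.
have dist_has (y : H) : has_inf [set `|y - c| | c in C].
  by split; [exists `|y - x|, x|exists 0 => _ [c _ <-]].
have dist0 (y : H) : 0 <= distance C y.
  by apply: lb_le_inf => [|_ [c _ <-]]; first exact: (dist_has y).1.
have dist_le (y : H) : distance C y <= `|y - x|.
  by apply: ge_inf; [exact: (dist_has y).2|exists x].
have lag u : 2^-1 * `|z - adjoint L u| ^+ 2 - 2^-1 * `|z - adjoint L u - x| ^+ 2
    + inner (L x - r) u + inner u r = m.
  rewrite (normB_sq (z - adjoint L u)) /m !innerDl !innerNl.
  by rewrite adjointP// (innerC r) (innerC x (adjoint _ _)); lra.
rewrite /dual_objective; apply: (@le_trans _ _ m%:E).
  have -> : support_function D v = (inner (L x - r) v)%:E.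
    apply/eqP; rewrite eq_le; apply/andP; split.
      apply: ge_ereal_sup => _ [d Dd <-]; rewrite lee_fin -subr_le0.
      by rewrite -innerNl -innerDl innerC; exact: vD.
    by apply: ereal_sup_ubound; exists (L x - r).
  have -> : distance C (z - adjoint L v) = `|z - adjoint L v - x|.
    apply/eqP; rewrite eq_le dist_le/=; apply: lb_le_inf => [|_ [c Cc <-]].
      exact: (dist_has _).1.
    rewrite -ler_sqr ?nnegrE//.
    have -> : z - adjoint L v - c = (z - adjoint L v - x) - (c - x).
      by rewrite opprB addrA subrK.
    rewrite (normB_sq (z - adjoint L v - x)).
    by have := vC _ Cc; have := sqr_ge0 `|c - x|; lra.
  by rewrite -!EFinD lee_fin lag.
rewrite -(lag w) EFinD; apply: leeD => //.
rewrite EFinD; apply: leeD.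
  rewrite lee_fin lerD2l lerN2 ler_pM2l// ler_sqr ?nnegrE//.
by apply: ereal_sup_ubound; exists (L x - r).
Qed.

End KuhnTucker.

(** * The forward-backward step *)

(** For [l] the operator norm, [s = |y - v|] and [t = |p - x|], this absorbs the cross term of
    [dual_step_monotone]. After multiplication by [1 - q / 2] it is a completed square plus a term
    whose sign comes from [2 * (1 - q / 2) ^+ 2 >= 2 * (1 - q)]. *)
Lemma step_size_quadratic {R : realType} (l g q s t : R) :
  0 < q -> q <= 1 -> 0 <= g -> g * l ^+ 2 <= 2 * (1 - q) ->
  q / 2 * s ^+ 2 + g * q * t ^+ 2 + 2 * g * (l * t * s) <=
    s ^+ 2 + 2 * g * t ^+ 2.
Proof.
move=> q0 q1 g0 gl; rewrite -subr_ge0.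
have m0 : 0 < 1 - q / 2 by lra.
rewrite -(pmulr_rge0 _ m0).
rewrite (_ : _ * _ = ((1 - q / 2) * s - g * l * t) ^+ 2 +
  g * t ^+ 2 * (2 * (1 - q / 2) ^+ 2 - g * l ^+ 2)); last by field.
apply: addr_ge0; first exact: sqr_ge0.
apply: mulr_ge0; first by rewrite mulr_ge0 ?sqr_ge0.
rewrite (_ : 2 * (1 - q / 2) ^+ 2 = 2 * (1 - q) + q ^+ 2 / 2); last by field.
by have := sqr_ge0 q; lra.
Qed.

Section ForwardBackward.
Context {R : realType} {H G : hilbertType R}.
Variables (z : H) (r : G) (C : set H) (D : set G) (L : {linear H -> G}) (x : H).
Hypotheses (Cc : closed C) (Ccvx : convex_set C).
Hypotheses (Dc : closed D) (Dcvx : convex_set D).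
Hypothesis Lb : bounded_near L (nbhs (0 : H)).
Hypotheses (Cx : C x) (DLx : D (L x - r)).

Let C0 : C !=set0. Proof. by exists x. Qed.
Let D0 : D !=set0. Proof. by exists (L x - r). Qed.

Definition primal_iterate (v : G) : H := projector C (z - adjoint L v).

(** By Moreau's decomposition this is the proximal step of [g] times the support function of [D],
    taken at [v + g *: (L p - r)] with [p = primal_iterate v]. *)
Definition dual_step (g : R) (v : G) : G :=
  v + g *: (L (primal_iterate v) - r
            - projector D (g^-1 *: v + L (primal_iterate v) - r)).

(** Monotonicity of normal cones: [h1] compares [y] and [v0] as normals to [D] at [d] and [L x - r],
    [h2] compares the normals to [C] at [p] and [x]. Their combination [h3] bounds
    [<y - v, y - v0>]. *)
Lemma dual_step_monotone v0 v g : 0 < g -> kuhn_tucker z r C D L x v0 ->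
  let p := primal_iterate v in let y := dual_step g v in
  `|y - v0| ^+ 2 + `|y - v| ^+ 2 + 2 * g * `|p - x| ^+ 2 <=
    `|v - v0| ^+ 2 + 2 * g * inner (L (p - x)) (y - v).
Proof.
move=> g0 [vC vD] /=; set p := primal_iterate v; set y := dual_step g v.
set w := g^-1 *: v + L p - r; pose d := projector D w.
have Cp : C p by exact: projector_mem.
have Dd : D d by exact: projector_mem.
have yv : y - v = g *: (L p - r - d) by rewrite /y /dual_step addrC addKr.
have gy : g^-1 *: y = w - d.
  rewrite -(subrK v y) yv scalerDr scalerA mulVf ?gt_eqF// scale1r.
  by rewrite addrC !addrA.
have h1 : inner (y - v0) (L x - r - d) <= 0.
  have : inner y (L x - r - d) <= 0.
    have := projector_variational Dc Dcvx D0 w DLx.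
    by rewrite -/d -gy innerZl pmulr_rle0// invr_gt0.
  have := vD _ Dd; rewrite -[L x - r - d]opprB !innerNr innerDl innerNl.
  by lra.
have h2 : `|p - x| ^+ 2 <= inner (L (p - x)) (v0 - v).
  have := projector_variational Cc Ccvx C0 (z - adjoint L v) Cx.
  have := vC _ Cp; rewrite -/(primal_iterate v) -/p.
  have -> : x - p = - (p - x) by rewrite opprB.
  have -> : `|p - x| ^+ 2 = inner p (p - x) - inner x (p - x).
    by rewrite -inner_norm innerDl innerNl.
  have -> : inner (L (p - x)) (v0 - v) =
      inner (adjoint L v0) (p - x) - inner (adjoint L v) (p - x).
    by rewrite innerDr innerNr !adjointP// !(innerC (p - x)).
  rewrite !innerNr !innerDl !innerNl; lra.
have h3 : inner (y - v) (y - v0) <=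
    g * (inner (L (p - x)) (y - v) - `|p - x| ^+ 2).
  have -> : inner (y - v) (y - v0) =
      g * (inner (L (p - x)) (y - v0) + inner (L x - r - d) (y - v0)).
    rewrite [in LHS]yv innerZl -innerDl; congr (_ * inner _ _).
    by rewrite (linearB L) -[L x - r - d]addrA subrKA addrA.
  rewrite ler_pM2l//.
  have -> : inner (L (p - x)) (y - v0) =
      inner (L (p - x)) (y - v) - inner (L (p - x)) (v0 - v).
    by rewrite -innerNr -innerDr opprB addrA subrK.
  by rewrite [inner (L x - r - d) _]innerC; lra.
have -> : v - v0 = (y - v0) - (y - v) by rewrite opprB [RHS]addrC subrKA.
by rewrite (normB_sq (y - v0)) (innerC (y - v0)); lra.
Qed.

(** The cross term of [dual_step_monotone] is absorbed by [step_size_quadratic]; relaxation is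
    handled by [lam ^+ 2 <= lam] and [eps <= lam]. *)
Lemma relaxed_dual_step_fejer v0 v g q eps lam :
  kuhn_tucker z r C D L x v0 -> 0 < q -> q <= 1 -> 0 < eps -> eps <= g ->
  g * opnorm L ^+ 2 <= 2 * (1 - q) -> eps <= lam -> lam <= 1 ->
  `|v + lam *: (dual_step g v - v) - v0| ^+ 2 +
    eps * (q / 2 * `|dual_step g v - v| ^+ 2 +
           eps * q * `|primal_iterate v - x| ^+ 2) <= `|v - v0| ^+ 2.
Proof.
move=> kt0 q0 q1 eps0 epsg gl epslam lam1.
have g0 : 0 < g by exact: lt_le_trans epsg.
have /= := dual_step_monotone v g0 kt0.
set p := primal_iterate v; set y := dual_step g v => mono.
have inn : inner (L (p - x)) (y - v) <= opnorm L * `|p - x| * `|y - v|.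
  apply: le_trans (inner_le _ _) _; rewrite ler_wpM2r//; exact: opnormP.
have inng : 2 * g * inner (L (p - x)) (y - v) <=
    2 * g * (opnorm L * `|p - x| * `|y - v|).
  by rewrite ler_pM2l// mulr_gt0.
have quad := step_size_quadratic `|y - v| `|p - x| q0 q1 (ltW g0) gl.
have := sqr_ge0 `|y - v|; have := sqr_ge0 `|p - x|.
have -> : v + lam *: (y - v) - v0 = (v - v0) + lam *: (y - v) by rewrite addrAC.
rewrite (normD_sq (v - v0)) innerZr normrZ exprMn real_normK ?num_real//.
have yv0 : `|y - v0| ^+ 2 =
    `|v - v0| ^+ 2 + 2 * inner (v - v0) (y - v) + `|y - v| ^+ 2.
  by rewrite -(normD_sq (v - v0)) [v - v0 + _]addrC subrKA.
move: mono inng quad; rewrite {}yv0.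
move: (`|v - v0| ^+ 2) (`|y - v| ^+ 2) (`|p - x| ^+ 2) (inner (v - v0) _).
move=> A S T I.
move: (2 * g * _) (2 * g * _) (2 * g * _) => X Y W mono inng quad T0 S0.
have key : 2 * I + S + q / 2 * S + eps * q * T <= 0.
  have : eps * q * T <= g * q * T by rewrite !ler_wpM2r// ltW.
  by lra.
have lamkey : lam * (2 * I + S + q / 2 * S + eps * q * T) <= 0.
  by rewrite pmulr_rle0//; lra.
have h1 : lam ^+ 2 * S <= lam * S by rewrite ler_wpM2r// expr2 ler_piMl//; lra.
have h2 : eps * (q / 2 * S + eps * q * T) <= lam * (q / 2 * S + eps * q * T).
  by rewrite ler_wpM2r// addr_ge0// !mulr_ge0//; lra.
lra.
Qed.

(** The graph of a normal cone is closed for bounded weakly convergent normals at strongly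
    convergent points. *)
Lemma weak_limit_kuhn_tucker (U : set_system nat) {UU : ProperFilter U}
    (g : nat -> R) (v : nat -> G) w (eps B : R) :
  0 < eps -> (forall n, eps <= g n) -> (forall n, `|v n| <= B) ->
  weak_limit U v w ->
  primal_iterate (v n) @[n --> U] --> x ->
  (dual_step (g n) (v n) - v n) @[n --> U] --> (0 : G) ->
  kuhn_tucker z r C D L x w.
Proof.
move=> eps0 epsg vB vw px yv.
pose p n := primal_iterate (v n); pose y n := dual_step (g n) (v n).
have Lp : L (p n) @[n --> U] --> L x.
  by apply: continuous_cvg => //; exact: bounded_linear_continuous.
split=> [c Cc'|d Dd].
  have pc : (c - p n) @[n --> U] --> c - x by apply: cvgB => //; exact: cvg_cst.
  have lim : inner (z - p n) (c - p n) - inner (v n) (L c - L (p n)) @[n --> U]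
      --> inner (z - x) (c - x) - inner w (L c - L x).
    apply: cvgB.
      by apply: inner_cvg => //; apply: cvgB => //; exact: cvg_cst.
    by apply: (weak_strong_cvg vB vw); apply: cvgB => //; exact: cvg_cst.
  have adjB u q : inner (z - q) (c - q) - inner u (L c - L q) =
      inner (z - adjoint L u - q) (c - q).
    rewrite -(linearB L) (innerC u) adjointP// (innerC (c - q)).
    by rewrite -innerNl -innerDl addrAC.
  rewrite -adjB; apply: (cvgr_to_le lim); apply: nearW => n.
  by rewrite adjB; exact: projector_variational.
pose dn n := projector D ((g n)^-1 *: v n + L (p n) - r).
have yvE n : y n - v n = g n *: (L (p n) - r - dn n).
  by rewrite /y /dual_step addrC addKr.
have g0 n : 0 < g n by exact: lt_le_trans (epsg n).
(* [dn n] differs from [L (p n) - r] by [(y n - v n) / g n], and [g n] stays above [eps]. *)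
have dn_cvg : dn @ U --> L x - r.
  rewrite (_ : dn = fun n => (L (p n) - r) - (g n)^-1 *: (y n - v n));
    last first.
    by apply/funext => n; rewrite yvE scalerA mulVf ?gt_eqF// scale1r subKr.
  rewrite -[L x - r]subr0; apply: cvgB.
    by apply: cvgB => //; exact: cvg_cst.
  apply: (@norm_le_cvg0 _ _ _ _ _ _ (fun n => eps^-1 * `|y n - v n|)).
    apply: nearW => n; rewrite normrZ gtr0_norm ?invr_gt0//.
    by rewrite ler_wpM2r// lef_pV2 ?posrE.
  rewrite -(mulr0 eps^-1) -(@normr0 _ G); apply: cvgM; first exact: cvg_cst.
  exact: cvg_norm.
have dd : (d - dn n) @[n --> U] --> d - (L x - r).
  by apply: cvgB => //; exact: cvg_cst.
(* The normal to [D] at [dn n] is [y n], here split as [v n + (y n - v n)]. *)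
have lim : inner (v n) (d - dn n) + inner (y n - v n) (d - dn n) @[n --> U]
    --> inner w (d - (L x - r)) + inner 0 (d - (L x - r)).
  apply: cvgD; first exact: weak_strong_cvg vB vw dd.
  exact: inner_cvg.
rewrite -[inner w _]addr0 -[X in _ + X](inner0l (d - (L x - r))).
apply: (cvgr_to_le lim); apply: nearW => n.
rewrite -innerDl addrC subrK.
have := projector_variational Dc Dcvx D0 ((g n)^-1 *: v n + L (p n) - r) Dd.
rewrite -/(dn n).
have -> : (g n)^-1 *: v n + L (p n) - r - dn n = (g n)^-1 *: y n.
  rewrite -(subrK (v n) (y n)) yvE scalerDr scalerA mulVf ?gt_eqF// scale1r.
  by rewrite [RHS]addrC !addrA.
by rewrite innerZl pmulr_rle0// invr_gt0.
Qed.

End ForwardBackward.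

(** The error [b] enters through [L b] and again through the projector, which is nonexpansive; hence
    the factor 2. *)
Lemma inexact_dual_step_error {R : realType} {H G : hilbertType R} (z b : H)
    (r c v : G) (C : set H) (D : set G) (L : {linear H -> G}) (g lam : R) :
  closed D -> convex_set D -> D !=set0 -> bounded_near L (nbhs (0 : H)) ->
  0 <= lam -> lam <= 1 -> 0 <= g ->
  let p := primal_iterate z C L v in
  `|v + (lam * g) *:
      (L (p + b) - r - projector D (g^-1 *: v + L (p + b) - r) + c) -
    (v + lam *: (dual_step z r C D L g v - v))| <=
  g * (2 * opnorm L * `|b| + `|c|).
Proof.
move=> Dc Dcvx D0 Lb lam0 lam1 g0 /=; rewrite /dual_step.
set p := primal_iterate z C L v.
set d' := projector D (_ + L (p + b) - r); set d := projector D (_ + L p - r).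
have dd' : `|d - d'| <= `|L b|.
  apply: le_trans (projector_nonexpansive Dc Dcvx D0 _ _) _.
  rewrite (linearD L) !addrA opprB addrA subrK opprD addrA subrr add0r.
  by rewrite normrN.
have -> : v + (lam * g) *: (L (p + b) - r - d' + c)
    - (v + lam *: (v + g *: (L p - r - d) - v)) =
    (lam * g) *: (L b + (d - d') + c).
  rewrite [v + g *: _ - v]addrAC subrr add0r scalerA opprD addrACA subrr add0r.
  rewrite -scalerBr; congr (_ *: _).
  rewrite (linearD L) [L p + L b - r]addrAC.
  move: (L p - r) => A.
  by rewrite opprB [LHS]addrC -!addrA addKr [LHS]addrCA.
have Lb' := opnormP Lb b.
rewrite normrZ ger0_norm ?mulr_ge0// -[lam * g * _]mulrA.
apply: (@le_trans _ _ (g * `|L b + (d - d') + c|)).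
  by rewrite ler_piMl// mulr_ge0.
rewrite ler_wpM2l//; apply: le_trans (ler_normD _ _) _; rewrite lerD2r.
by apply: le_trans (ler_normD _ _) _; lra.
Qed.

(** * Convergence of the inexact iteration *)

Theorem proposition4p2 (R : realType) (H G : hilbertType R)
    (z : H) (r : G) (C : set H) (D : set G) (L : {linear H -> G})
    (x : H) (b : nat -> H) (c : nat -> G) (eps : R) (v0 : G)
    (gamma lambda : nat -> R) (xs : nat -> H) (vs : nat -> G) :
  closed C -> convex_set C ->
  closed D -> convex_set D ->
  bounded_near L (nbhs (0 : H)) ->
  (exists u : H, L u != 0) ->
  sri (set_sub (L @` C) D) r ->
  primal_solution z r C D L x ->
  (\sum_(0 <= n <oo) `|b n|%:E < +oo)%E ->
  (\sum_(0 <= n <oo) `|c n|%:E < +oo)%E ->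
  0 < eps < Num.min 1 (opnorm L ^- 2) ->
  (forall n, eps <= gamma n <= 2 * opnorm L ^- 2 - eps) ->
  (forall n, eps <= lambda n <= 1) ->
  (forall n, xs n = projector C (z - adjoint L (vs n)) + b n) ->
  vs 0%N = v0 ->
  (forall n, vs n.+1 = vs n + (lambda n * gamma n) *:
     (L (xs n) - r - projector D ((gamma n)^-1 *: vs n + L (xs n) - r) + c n)) ->
  (exists v : G, [/\ dual_solution z r C D L v, weak_cvg vs v
                   & x = projector C (z - adjoint L v)])
  /\ xs @ \oo --> x.
Proof.
move=> Cc Ccvx Dc Dcvx Lb Lnz rsri xP bsum csum epsb gam lamb xsE _ vsE.
have [[Cx DLx] _] := xP.
have D0 : D !=set0 by exists (L x - r).
have [vL vLP] := lagrange_multiplier Cc Ccvx Dc Dcvx Lb rsri xP.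
have ktL := lagrange_kuhn_tucker Lb Cx DLx vLP.
have l0 := opnorm_gt0 Lb Lnz.
set l := opnorm L in l0 epsb gam *.
have l2 : 0 < l ^+ 2 by rewrite exprn_gt0.
move: epsb; rewrite lt_min => /andP[eps0 /andP[_ epsl]].
have epsl1 : eps * l ^+ 2 < 1 by rewrite -ltr_pdivlMr// div1r.
(* With this [q] the bound [gamma n <= 2 * l ^- 2 - eps] becomes
   [gamma n * l ^+ 2 <= 2 * (1 - q)]. *)
pose q := eps * l ^+ 2 / 2.
have q0 : 0 < q by rewrite divr_gt0// mulr_gt0.
have q1 : q <= 1 by rewrite /q; lra.
have epsg n : eps <= gamma n by case/andP: (gam n).
have g0 n : 0 < gamma n by exact: lt_le_trans (epsg n).
have gl n : gamma n * l ^+ 2 <= 2 * (1 - q).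
  have /andP[_ gn] := gam n.
  apply: (@le_trans _ _ ((2 * l ^- 2 - eps) * l ^+ 2)).
    by rewrite ler_pM2r.
  by rewrite mulrBl divfK ?gt_eqF// /q; lra.
have gle n : gamma n <= 2 * l ^- 2 by have /andP[_] := gam n; lra.
have epslam n : eps <= lambda n by case/andP: (lamb n).
have lam1 n : lambda n <= 1 by case/andP: (lamb n).
have lam0 n : 0 <= lambda n by apply: le_trans (epslam n); exact: ltW.
have [Bb BbP] := nneseries_lty_bounded (fun n => normr_ge0 (b n)) bsum.
have [Bc BcP] := nneseries_lty_bounded (fun n => normr_ge0 (c n)) csum.
pose p n := primal_iterate z C L (vs n).
pose y n := dual_step z r C D L (gamma n) (vs n).
(* The bound of [inexact_dual_step_error] with [gamma n] replaced by a uniform upper bound, hence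
   summable. *)
pose e n := 2 * l ^- 2 * (2 * l * `|b n| + `|c n|).
have e0 n : 0 <= e n by rewrite mulr_ge0 ?addr_ge0 ?mulr_ge0// ltW// ?invr_gt0.
have eB : exists B, forall n, \sum_(0 <= i < n) e i <= B.
  exists (2 * l ^- 2 * (2 * l * Bb + Bc)) => n.
  rewrite -mulr_sumr ler_wpM2l ?mulr_ge0 ?invr_ge0 ?(ltW l2)//.
  rewrite big_split/= -mulr_sumr; apply: lerD => //.
  by rewrite ler_wpM2l ?mulr_ge0 ?(ltW l0).
pose del n := eps * (q / 2 * `|y n - vs n| ^+ 2 + eps * q * `|p n - x| ^+ 2).
have del0 n : 0 <= del n.
  by rewrite mulr_ge0 ?addr_ge0 ?mulr_ge0 ?sqr_ge0 ?invr_ge0// ltW.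
(* Stated for every Kuhn-Tucker vector, as Opial's lemma requires; [vL] provides one, which yields
   the decay of [del]. *)
have fejer v : kuhn_tucker z r C D L x v ->
    cvgn (fun n => `|vs n - v|) /\ del @ \oo --> (0 : R).
  move=> ktv; apply: (@quasi_fejer _ _ del e) => // n.
  pose s := `|vs n + lambda n *: (y n - vs n) - v|.
  exists s; split; first exact: normr_ge0.
    exact: (relaxed_dual_step_fejer Cc Ccvx Dc Dcvx Lb Cx DLx (vs n) ktv q0 q1
      eps0 (epsg n) (gl n) (epslam n) (lam1 n)).
  rewrite [leRHS]addrC.
  have -> : vs n.+1 - v = (vs n.+1 - (vs n + lambda n *: (y n - vs n))) +
      (vs n + lambda n *: (y n - vs n) - v) by rewrite subrKA.
  apply: le_trans (ler_normD _ _) _; rewrite lerD2r.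
  rewrite vsE xsE -/(primal_iterate z C L (vs n)).
  have := @inexact_dual_step_error _ _ _ z (b n) r (c n) (vs n) C D L (gamma n)
    (lambda n) Dc Dcvx D0 Lb (lam0 n) (lam1 n) (ltW (g0 n)).
  move/le_trans; apply.
  by rewrite ler_wpM2r// addr_ge0// mulr_ge0// mulr_ge0// ltW.
have [cvL del_cvg] := fejer _ ktL.
have term0 (V : normedModType R) (f : nat -> V) K : 0 < K ->
    (forall n, K * `|f n| ^+ 2 <= del n) -> f @ \oo --> (0 : V).
  move=> K0 Kf; apply: norm_sq_cvg0.
  apply: (@norm_le_cvg0 _ R^o _ _ _ _ (fun n => K^-1 * del n)).
    by apply: nearW => n; rewrite ger0_norm ?sqr_ge0// ler_pdivlMl.
  by rewrite -(mulr0 K^-1); apply: cvgM => //; exact: cvg_cst.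
have yv0 : (fun n => y n - vs n) @ \oo --> (0 : G).
  apply: (term0 _ _ (eps * (q / 2))); first by rewrite mulr_gt0// divr_gt0.
  move=> n; rewrite -mulrA ler_pM2l// lerDl.
  by rewrite mulr_ge0 ?sqr_ge0// ltW// mulr_gt0.
have px : p @ \oo --> x.
  have px0 : (fun n => p n - x) @ \oo --> (0 : H).
    apply: (term0 _ _ (eps * (eps * q))); first by rewrite !mulr_gt0.
    move=> n; rewrite -mulrA ler_pM2l// lerDr.
    by rewrite mulr_ge0 ?sqr_ge0// ltW// divr_gt0.
  rewrite (_ : p = fun n => (p n - x) + x); last first.
    by apply/funext => n; rewrite subrK.
  by rewrite -[X in _ --> X]add0r; apply: cvgD => //; exact: cvg_cst.
have [Bv BvP] : exists B, forall n, `|vs n| <= B.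
  have /cvg_seq_bounded/pinfty_ex_gt0[M M0 /= vM] := cvL.
  exists (M + `|vL|) => n; rewrite -[vs n](subrK vL).
  apply: le_trans (ler_normD _ _) _; rewrite lerD2r.
  by have := vM n I; rewrite /= normr_id.
split; last first.
  rewrite (_ : xs = fun n => p n + b n); last by apply/funext => n; rewrite xsE.
  rewrite -[x]addr0; apply: cvgD => //; apply: norm_cvg0.
  apply: cvg_series_cvg_0; apply: bounded_series_cvg => //.
  by exists Bb.
have [|U UU subU w vw|w [ktw vw]] := opial BvP (S := kuhn_tucker z r C D L x).
- by move=> w /fejer[].
- apply: (weak_limit_kuhn_tucker Cc Ccvx Dc Dcvx Lb Cx DLx eps0 epsg BvP vw).
    by move=> A /px /subU.
  by move=> A /yv0 /subU.
exists w; split=> //; first exact: (kuhn_tucker_dual_solution Lb Cx DLx ktw).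
by apply/esym; exact: (kuhn_tucker_projector Cx ktw).
Qed.
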